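(* Let $k\ge 2$ be an integer and let $T$ be a tree of order $n\ge 8$ and diameter $n-t$, where $2\le t\le n-3$. (i) If $2\le t\le \frac{n-1}{3}$, then $n-2t\le \alpha_{k-reg}(T)\le n-4$. (ii) If $\frac{n}{3}\le t\le n-5$, then $\frac{n+2}{3}\le \alpha_{k-reg}(T)\le \max\{n-f(n,t)-1,\ t+1\}$. (iii) If $t=n-4$, then $\lceil \frac{n-1}{2}\rceil\le \alpha_{k-reg}(T)\le t+1$. (iv) If $t=n-3$, then $\alpha_{k-reg}(T)=t+1$.
   Context: All graphs are finite, simple and undirected. For a graph $G$ and an integer $i\ge 0$, $D_i(G)$ denotes the set of vertices of degree $i$ in $G$. For an integer $k\ge 0$, a set $S\subseteq V(G)$ is $k$-independent if the induced subgraph $G[S]$ has maximum degree at most $k$. A regular $k$-independent set is a $k$-independent set $S$ with $S\subseteq D_i(G)$ for some $i$. The regular $k$-independence number $\alpha_{k-reg}(G)$ is the maximum cardinality of a regular $k$-independent set of $G$. For integers $n>t\ge 2$ with $t\le n-3$, define $f(n,t)=\lceil \frac{2(t-1)}{n-t}\rceil+2$ if $n-t$ is even, and $f(n,t)=\lceil\frac{2(t-1)}{n-t-1}\rceil+2$ if $n-t$ is odd. *)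

(* Defs.v *)
From mathcomp Require Import all_boot.

Set Implicit Arguments.
Unset Strict Implicit.
Unset Printing Implicit Defensive.

Section Graph.

Variables (V : finType) (e : rel V).

Definition simple_graph : Prop := symmetric e /\ irreflexive e.

Definition connected_graph : Prop := forall x y : V, connect e x y.

(* Since e is symmetric, [:: x; y] is a ucycle for every edge xy; the cycles
   of the graph are the ucycles with at least 3 vertices. *)
Definition acyclic_graph : Prop :=
  forall c : seq V, ucycle e c -> size c < 3.

Definition tree : Prop :=
  [/\ simple_graph, 0 < #|V|, connected_graph & acyclic_graph].

Definition deg (x : V) : nat := #|[set y | e x y]|.

(* D_i(G) *)
Definition degree_class (i : nat) : {set V} := [set x | deg x == i].

Definition walk_of_length (x y : V) (d : nat) : bool :=
  [exists p : d.-tuple V, path e x p && (last x p == y)].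

(* The least d with a walk of length d from x to y; by find's default, #|V|
   if x and y are not connected. *)
Definition dist (x y : V) : nat := find (walk_of_length x y) (iota 0 #|V|).

Definition diameter : nat := \max_(x : V) \max_(y : V) dist x y.

Definition induced_max_degree (S : {set V}) : nat :=
  \max_(x in S) #|[set y in S | e x y]|.

Definition k_independent (k : nat) (S : {set V}) : bool :=
  induced_max_degree S <= k.

(* i may be taken below #|V|, as all degrees of a simple graph are. *)
Definition regular_k_independent (k : nat) (S : {set V}) : bool :=
  k_independent k S && [exists i : 'I_#|V|, S \subset degree_class i].

Definition alpha_reg (k : nat) : nat :=
  \max_(S : {set V} | regular_k_independent k S) #|S|.

End Graph.

(* The ceiling of m / d, for d > 0. *)
Definition ceil_divn (m d : nat) : nat := m %/ d + ~~ (d %| m).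

Definition f (n t : nat) : nat :=
  if odd (n - t) then ceil_divn (2 * (t - 1)) (n - t - 1) + 2
  else ceil_divn (2 * (t - 1)) (n - t) + 2.

(* Main.v *)
Require Import Defs.
From mathcomp Require Import all_boot zify.

(** Write n_1, n_2 and n_3 for the numbers of vertices of degree 1, 2 and at
    least 3. The degree sum 2n - 2 of a tree gives n_3 + 2 <= n_1, so no degree
    class above 2 is larger than n_1; as the classes of degree 1 and 2 are
    2-independent, the regular k-independence number is max(n_1, n_2).

    Let d = n - t be the diameter, attained between x and y. The d - 1 inner
    vertices of the path from x to y are not leaves, whence n_1 <= t + 1. Each
    of the t - 1 vertices v off the path has a leaf w below it. The sum of the
    distances from v to x and y is at least d + 2 (it exceeds d and has the
    parity of d), while w is at distance at most d from x and from y; so v is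
    one of the floor(d / 2) vertices nearest to w on the path from w to x.
    Hence t - 1 <= (n_1 - 2) * floor(d / 2), which says that f(n, t) <= n_1,
    and the claims are arithmetic consequences of f(n, t) <= n_1 <= t + 1. *)

Set Implicit Arguments.
Unset Strict Implicit.
Unset Printing Implicit Defensive.

Lemma leq_card_bigcup (I : Type) (T : finType) (r : seq I) (P : pred I)
    (F : I -> {set T}) :
  #|\bigcup_(i <- r | P i) F i| <= \sum_(i <- r | P i) #|F i|.
Proof.
elim/big_rec2: _ => [|i m A _ le_Am]; first by rewrite cards0.
by apply: leq_trans (leq_card_setU _ _) _; rewrite leq_add2l.
Qed.

Lemma card_set_sum (T : finType) (P : pred T) : #|[set x | P x]| = \sum_x P x.
Proof.
by rewrite -sum1dep_card big_mkcond; apply: eq_bigr => x _; case: (P x).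
Qed.

Lemma leq_ceil_divn m d q : 0 < d -> (ceil_divn m d <= q) = (m <= q * d).
Proof.
move=> d_gt0; rewrite /ceil_divn /dvdn {3}(divn_eq m d).
have := ltn_pmod m d_gt0; move: (m %/ d) (m %% d) => a [|r] lt_rd /=.
  by rewrite !addn0 leq_pmul2r.
by rewrite addn1; apply/idP/idP; nia.
Qed.

Lemma ceil_divnMl p m d : 0 < p -> ceil_divn (p * m) (p * d) = ceil_divn m d.
Proof. by move=> p_gt0; rewrite /ceil_divn divnMl // dvdn_pmul2l. Qed.

Lemma fE n t : f n t = ceil_divn (t - 1) (n - t)./2 + 2.
Proof.
rewrite -(ceil_divnMl _ _ (ltn0Sn 1)) /f.
by case: ifP => odd_nt; congr (ceil_divn _ _ + _); lia.
Qed.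

Lemma leq_f n t m : 1 < n - t -> 1 < m ->
  (f n t <= m) = (t - 1 <= (m - 2) * (n - t)./2).
Proof.
by move=> nt_gt1 m_gt1; rewrite fE addnC -leq_subRL // leq_ceil_divn; lia.
Qed.

Section Degrees.

Variables (V : finType) (e : rel V).

Definition branch_vertices : {set V} := [set x | 2 < deg e x].

Lemma alpha_reg_le k m :
  (forall i, #|degree_class e i| <= m) -> alpha_reg e k <= m.
Proof.
move=> le_m; apply/bigmax_leqP => S /andP[_ /existsP[i sub_i]].
exact: leq_trans (subset_leq_card sub_i) (le_m i).
Qed.

Lemma card_degree_class_le_alpha_reg k i :
  i <= k -> i < #|V| -> #|degree_class e i| <= alpha_reg e k.
Proof.
move=> le_ik lt_iV; apply: (bigmax_sup (degree_class e i)) => //.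
apply/andP; split; last by apply/existsP; exists (Ordinal lt_iV).
apply/bigmax_leqP => x; rewrite inE => /eqP deg_x.
apply: leq_trans le_ik; rewrite -deg_x.
by apply/subset_leq_card/subsetP => y; rewrite !inE => /andP[].
Qed.

Lemma neighbour_avoiding x y : 1 < deg e x -> exists2 z, e x z & z != y.
Proof.
move=> /card_gt1P[a [b []]]; rewrite !inE => xa xb ab.
by have [ay|ay] := eqVneq a y; [exists b; rewrite -?ay 1?eq_sym | exists a].
Qed.

Lemma leaf_neighbour_unique x y z : deg e x = 1 -> e x y -> e x z -> y = z.
Proof.
move=> deg_x xy xz.
have /card_le1_eqP : #|[set y | e x y]| <= 1 by rewrite -/(deg e x) deg_x.
by apply; rewrite inE.
Qed.

End Degrees.

Section Distance.

Variables (V : finType) (e : rel V).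

Local Notation D := (dist e).

Lemma walk_of_lengthP x y d :
  reflect (exists p, [/\ path e x p, last x p = y & size p = d])
          (walk_of_length e x y d).
Proof.
apply: (iffP existsP) => [[p /andP[ep /eqP lp]]|[p [ep lp /eqP sp]]].
  by exists p; rewrite size_tuple.
by exists (Tuple sp); rewrite /= ep lp eqxx.
Qed.

Lemma dist_le_card x y : D x y <= #|V|.
Proof. by rewrite -[leqRHS](size_iota 0) find_size. Qed.

Lemma dist_le_size x p : path e x p -> D x (last x p) <= size p.
Proof.
move=> ep; have [lt|ge] := ltnP (size p) #|V|; last first.
  exact: leq_trans (dist_le_card _ _) ge.
rewrite leqNgt; apply/negP => /(before_find 0).
rewrite nth_iota // add0n => /walk_of_lengthP; apply.
by exists p.
Qed.

Lemma shortest_walk x y : D x y < #|V| ->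
  exists p, [/\ path e x p, last x p = y & size p = D x y].
Proof.
move=> lt_DV; apply/walk_of_lengthP.
have : has (walk_of_length e x y) (iota 0 #|V|) by rewrite has_find size_iota.
by move/(nth_find 0); rewrite nth_iota.
Qed.

Lemma dist_lt_card x y : (D x y < #|V|) = connect e x y.
Proof.
apply/idP/connectP => [/shortest_walk[p [ep lp _]]|[q eq ->]].
  by exists p.
case: (shortenP eq) => p ep /card_uniqP/= up _.
by apply: leq_ltn_trans (dist_le_size ep) _; rewrite -up max_card.
Qed.

Lemma dist_eq0 x y : (D x y == 0) = (x == y).
Proof.
apply/eqP/eqP => [Dxy|<-]; last first.
  by apply/eqP; rewrite -leqn0 (@dist_le_size x [::]).
have [|p [_ lp sp]] := @shortest_walk x y.
  by rewrite Dxy; apply/card_gt0P; exists x.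
by rewrite -lp; move: sp; rewrite Dxy => /size0nil ->.
Qed.

Lemma dist_refl x : D x x = 0.
Proof. by apply/eqP; rewrite dist_eq0. Qed.

Lemma dist_gt0 x y : (0 < D x y) = (x != y).
Proof. by rewrite lt0n dist_eq0. Qed.

Lemma dist_triangle y x z : D x z <= D x y + D y z.
Proof.
have [Dxy|] := ltnP (D x y) #|V|; last by have := dist_le_card x z; lia.
have [Dyz|] := ltnP (D y z) #|V|; last by have := dist_le_card x z; lia.
have [p [ep lp <-]] := shortest_walk Dxy.
have [q [eq <- <-]] := shortest_walk Dyz.
by rewrite -lp -size_cat -last_cat dist_le_size // cat_path ep lp.
Qed.

Lemma dist_edge x y : e x y -> D x y <= 1.
Proof. by move=> xy; apply: (@dist_le_size x [:: y]); rewrite /= xy. Qed.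

Lemma dist_edge_le r x y : e x y -> D r y <= (D r x).+1.
Proof. by move=> /dist_edge; have := dist_triangle x r y; lia. Qed.

Lemma dist_le_diameter x y : D x y <= diameter e.
Proof. exact: leq_trans (leq_bigmax y) (leq_bigmax x). Qed.

Lemma diameter_attained : 0 < #|V| -> exists x y, D x y = diameter e.
Proof.
move=> V_gt0; rewrite /diameter.
have [x ->] := eq_bigmax (fun x => \max_(y : V) D x y) V_gt0.
by have [y ->] := eq_bigmax (D x) V_gt0; exists x, y.
Qed.

Hypothesis e_sym : symmetric e.

Lemma walk_of_length_rev x y d :
  walk_of_length e x y d -> walk_of_length e y x d.
Proof.
move=> /walk_of_lengthP[p [ep <- sp]]; apply/walk_of_lengthP.
exists (rev (belast x p)); rewrite rev_path size_rev size_belast; split=> //.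
  by rewrite (eq_path (e' := e)) // => u v; apply: e_sym.
by case: p {ep sp} => //= a p; rewrite rev_cons last_rcons.
Qed.

Lemma dist_sym x y : D x y = D y x.
Proof.
by rewrite /dist; apply: eq_find => d; apply/idP/idP; apply: walk_of_length_rev.
Qed.

Definition interval x y : {set V} := [set v | D x v + D v y == D x y].

Lemma intervalP x y v : reflect (D x v + D y v = D x y) (v \in interval x y).
Proof. by rewrite inE (dist_sym v); apply: eqP. Qed.

Lemma interval_sym x y : interval x y = interval y x.
Proof.
apply/setP => v.
by rewrite !inE addnC (dist_sym y x) (dist_sym v x) (dist_sym v y).
Qed.

Lemma left_in_interval x y : x \in interval x y.
Proof. by apply/intervalP; rewrite dist_refl dist_sym. Qed.

Lemma right_in_interval x y : y \in interval x y.
Proof. by rewrite interval_sym left_in_interval. Qed.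

Lemma dist_notin_interval x y v :
  v \notin interval x y -> D x y < D x v + D y v.
Proof.
by move=> /intervalP; have := dist_triangle v x y; rewrite (dist_sym v y); lia.
Qed.

Lemma interval_closer x y v a : v \in interval x y -> e v a -> D y a < D y v ->
  a \in interval x y /\ D x a = (D x v).+1.
Proof.
move=> /intervalP vxy va a_closer.
have := dist_triangle a x y; rewrite (dist_sym a y).
by have := dist_edge_le x va; split; [apply/intervalP|]; lia.
Qed.

Lemma interval_extend r v w z : v \in interval r w -> e w z ->
  D r z = (D r w).+1 -> v \in interval r z /\ D v z = (D v w).+1.
Proof.
move=> /intervalP; rewrite (dist_sym w) => vrw wz Drz.
have := dist_edge_le v wz; have := dist_triangle v r z.
by split; [apply/intervalP; rewrite (dist_sym z)|]; lia.
Qed.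

Hypothesis e_connected : connected_graph e.

Lemma closer_neighbour r x : x != r ->
  exists2 y, e x y & (D r y).+1 = D r x.
Proof.
have := e_connected x r; rewrite -dist_lt_card => /shortest_walk.
rewrite (dist_sym r x) => -[[|y p] [/= ep lp sp]] xr.
  by rewrite lp eqxx in xr.
move/andP: ep => [xy /dist_le_size]; rewrite lp => yr; exists y => //.
by have := dist_triangle y x r; have := dist_edge xy;
  rewrite (dist_sym r y); lia.
Qed.

Lemma interval_step x y v : v \in interval x y -> v != y ->
  exists a, [/\ e v a, a \in interval x y, D x a = (D x v).+1
              & (D y a).+1 = D y v].
Proof.
move=> vxy /closer_neighbour[a va Dya]; exists a.
by have [|axy Dxa] := interval_closer vxy va; first by rewrite -Dya.
Qed.

Lemma interval_at_dist x y i : i <= D x y ->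
  exists2 v, v \in interval x y & D x v = i.
Proof.
elim: i => [|i IH] lt_i.
  by exists x; rewrite ?left_in_interval ?dist_refl.
have [v vxy Dxv] := IH (ltnW lt_i).
have vy : v != y by apply: contraTneq lt_i => <-; rewrite Dxv ltnn.
by have [a [_ axy Dxa _]] := interval_step vxy vy; exists a; rewrite ?Dxa ?Dxv.
Qed.

Lemma card_interval_gt x y : D x y < #|interval x y|.
Proof.
pose g v : 'I_(D x y).+1 := inord (D x v).
suff <- : #|g @: interval x y| = (D x y).+1 by exact: leq_imset_card.
rewrite -[RHS]card_ord -cardsT; apply: eq_card => i; rewrite inE; apply/imsetP.
have [v vxy Dxv] := @interval_at_dist x y i (ltn_ord i).
by exists v; rewrite /g ?Dxv ?inord_val.
Qed.

Lemma deg_gt0 x : 1 < #|V| -> 0 < deg e x.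
Proof.
move=> V_gt1; have /card_gt0P[r] : 0 < #|predC1 x| by rewrite cardC1; lia.
rewrite inE eq_sym => /closer_neighbour[y xy _].
by apply/card_gt0P; exists y; rewrite inE.
Qed.

Lemma leaf_in_interval x y v :
  v \in interval x y -> deg e v = 1 -> v \in [set x; y].
Proof.
move=> vxy deg_v; rewrite !inE; apply/norP => -[vx vy].
have [p vp Dxp] := closer_neighbour vx; have [q vq Dyq] := closer_neighbour vy.
have [|_] := interval_closer vxy vq; first lia.
by rewrite -(leaf_neighbour_unique deg_v vp vq); lia.
Qed.

Lemma card_leaves_diameter_le : 0 < #|V| ->
  #|degree_class e 1| + diameter e <= #|V|.+1.
Proof.
move=> /diameter_attained[x [y <-]].
have : degree_class e 1 \subset ~: interval x y :|: [set x; y].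
  apply/subsetP => v; rewrite inE => /eqP deg_v.
  rewrite in_setU in_setC -implybE.
  by apply/implyP => /leaf_in_interval; apply.
move/subset_leq_card; have [+ _] := leq_card_setU (~: interval x y) [set x; y].
have := cardsC (interval x y); have := card_interval_gt x y.
by rewrite cards2; case: eqP => _ /=; lia.
Qed.

Lemma connect_closer_closed r (S : {set V}) :
    (forall a b, a \in S -> e a b -> D r b < D r a -> b \in S) ->
  {in S, forall a, connect [rel u v in S | e u v] a r}.
Proof.
move=> closedS a; move: {2}(D r a) (leqnn (D r a)) => m.
elim: m a => [|m IH] a le_am aS.
  by move: le_am; rewrite leqn0 dist_eq0 => /eqP <-; apply: connect0.
have [->|/closer_neighbour[b ab Drb]] := eqVneq a r; first exact: connect0.
have bS : b \in S by apply: closedS aS ab _; lia.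
by apply: connect_trans (connect1 _) (IH b _ bS); rewrite /= ?aS ?bS //; lia.
Qed.

End Distance.

Lemma acyclic_neighbour_unique (V : finType) (e : rel V) (S : {set V}) x y z :
    symmetric e -> acyclic_graph e -> x \notin S -> e x y -> e x z ->
  connect [rel u v in S | e u v] y z -> y = z.
Proof.
move=> e_sym e_acyclic xS xy xz /connectP[q /shortenP[p ep up _] zE].
case: p zE ep up => [//|a p zE ep up].
have S_path : all [in S] [:: y, a & p].
  move: ep => /= /andP[/andP[/andP[-> ->] _]] /=.
  by elim: p a {zE up} => //= b p IH a /andP[/andP[/andP[_ ->] _] /IH].
have /e_acyclic // : ucycle e [:: x, y, a & p].
rewrite /ucycle cons_uniq up andbT; apply/andP; split; last first.
  by apply: contra xS => /(allP S_path).
rewrite /cycle rcons_path -[last x _]zE (e_sym z) xz andbT /= xy /=.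
by apply: sub_path ep => u v /andP[].
Qed.

Section Tree.

Variables (V : finType) (e : rel V).
Hypothesis treeT : tree e.

Let e_sym : symmetric e. Proof. by case: treeT => -[]. Qed.
Let e_irr : irreflexive e. Proof. by case: treeT => -[]. Qed.
Let e_connected : connected_graph e. Proof. by case: treeT. Qed.
Let e_acyclic : acyclic_graph e. Proof. by case: treeT. Qed.
Let V_gt0 : 0 < #|V|. Proof. by case: treeT. Qed.

Local Notation D := (dist e).

(* The vertices other than [x] that are no farther from [r] than [x] form a
   connected set. *)
Lemma nonfarther_neighbour_unique r x y z : e x y -> e x z ->
  D r y <= D r x -> D r z <= D r x -> y = z.
Proof.
move=> xy xz le_yx le_zx; pose S := [set a | (a != x) && (D r a <= D r x)].
have inS a : e x a -> D r a <= D r x -> a \in S.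
  move=> xa le_ax; rewrite inE le_ax andbT.
  by apply: contraTneq xa => ->; rewrite e_irr.
have xS : x \notin S by rewrite inE eqxx.
have to_r : {in S, forall a, connect [rel u v in S | e u v] a r}.
  apply: connect_closer_closed => // a b; rewrite !inE.
  move=> /andP[_ le_ax] _ lt_ba.
  rewrite (leq_trans (ltnW lt_ba)) // andbT.
  by apply: contraTneq lt_ba => ->; lia.
apply: (acyclic_neighbour_unique e_sym e_acyclic xS xy xz).
have S_sym : connect_sym [rel u v in S | e u v].
  by apply: sym_connect_sym => u v /=; rewrite e_sym [(u \in S) && _]andbC.
by apply: connect_trans (to_r y (inS y xy le_yx)) _; rewrite S_sym to_r ?inS.
Qed.

Lemma dist_edge_neq r x y : e x y -> D r x != D r y.
Proof.
move=> xy; apply: contraTneq (xy) => Drxy; have [xr|xr] := eqVneq x r.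
  move/eqP: Drxy; rewrite xr dist_refl eq_sym dist_eq0 => /eqP <-.
  by rewrite e_irr.
have [u xu Dru] := closer_neighbour e_sym e_connected xr.
have yu : y = u by apply: (nonfarther_neighbour_unique (r := r) xy xu); lia.
by subst u; lia.
Qed.

Lemma dist_edge_cases r x y : e x y -> (D r y).+1 = D r x \/ D r y = (D r x).+1.
Proof.
move=> xy; have := dist_edge_neq r xy; have := dist_edge_le r xy.
by have := @dist_edge_le _ e r y x; rewrite e_sym => /(_ xy); lia.
Qed.

Lemma dist_parity x y v : odd (D x v + D y v) = odd (D x y).
Proof.
pose A := [pred a | odd (D x a + D y a)].
have closedA : closed e A.
  move=> a b ab; rewrite !inE.
  by have [] := dist_edge_cases x ab; have [] := dist_edge_cases y ab; lia.
have := closed_connect closedA (e_connected v y).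
by rewrite !inE dist_refl addn0.
Qed.

Lemma card_closer_neighbours r x :
  #|[set y | e x y & D r y < D r x]| = (x != r).
Proof.
have [->|xr] /= := eqVneq x r.
  apply/eqP; rewrite cards_eq0; apply/eqP/setP => y.
  by rewrite !inE dist_refl andbF.
have [y xy Dry] := closer_neighbour e_sym e_connected xr.
apply/eqP/cards1P; exists y; apply/setP => z; rewrite !inE.
apply/andP/eqP => [[xz zx]|->]; last by rewrite -Dry.
by apply: (nonfarther_neighbour_unique (r := r) xz xy); lia.
Qed.

Lemma deg_farthest x y : x != y -> (forall z, D x z <= D x y) -> deg e y = 1.
Proof.
rewrite eq_sym => yx far.
have := card_closer_neighbours x y; rewrite yx /= => <-.
apply: eq_card => z; rewrite !inE; case: (boolP (e y z)) => //= yz.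
by have := far z; case: (dist_edge_cases x yz); lia.
Qed.

Lemma sum_card_neighbours_sym (P : rel V) :
  \sum_x #|[set y | e x y & P x y]| = \sum_x #|[set y | e x y & P y x]|.
Proof.
under eq_bigr => x _ do rewrite -sum1dep_card big_mkcond /=.
rewrite exchange_big; apply: eq_bigr => x _.
by rewrite -sum1dep_card [RHS]big_mkcond; apply: eq_bigr => y _; rewrite e_sym.
Qed.

Lemma sum_deg_tree : \sum_x deg e x + 2 = 2 * #|V|.
Proof.
have /card_gt0P[r _] := V_gt0.
have sum_closer : \sum_x #|[set y | e x y & D r y < D r x]| = #|V| - 1.
  rewrite subn1 -(cardC1 r) -sum1_card [RHS]big_mkcond.
  by apply: eq_bigr => x _; rewrite card_closer_neighbours !inE; case: eqP.
have degE x : deg e x = #|[set y | e x y & D r y < D r x]|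
                        + #|[set y | e x y & D r x < D r y]|.
  rewrite /deg -[LHS](cardsID [set y | D r y < D r x]).
  congr (_ + _); apply: eq_card => y; rewrite !inE // andbC -leqNgt leq_eqVlt.
  by case: (boolP (e x y)) => //= /(dist_edge_neq r)/negPf->.
rewrite (eq_bigr _ (fun x _ => degE x)) big_split /=.
rewrite (sum_card_neighbours_sym (fun x y => D r x < D r y)) sum_closer.
by have := V_gt0; move: #|V| => m; lia.
Qed.

Lemma interval_dist_inj x y : {in interval e x y &, injective (D y)}.
Proof.
move=> u v uxy vxy Duv; move Em: (D y u) => m.
elim: m u v uxy vxy Duv Em => [|m IH] u v uxy vxy Duv Em.
  have eq_y w : D y w = 0 -> w = y by move/eqP; rewrite dist_eq0 => /eqP.
  by rewrite (eq_y u) // (eq_y v) // -Duv.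
have neq_y w : D y w = m.+1 -> w != y by rewrite eq_sym -(dist_gt0 e) => ->.
have [a [ua axy Dxa Dya]] := interval_step e_sym e_connected uxy (neq_y u Em).
have [|b [vb bxy Dxb Dyb]] := interval_step e_sym e_connected vxy.
  by apply: neq_y; rewrite -Duv.
have ab : a = b by apply: IH; lia.
by subst b; apply: (nonfarther_neighbour_unique (r := x) (x := a));
  rewrite 1?e_sym //; lia.
Qed.

Lemma card_interval_ball x y m : #|[set v in interval e x y | D y v < m]| <= m.
Proof.
case: m => [|m].
  by rewrite leqn0 cards_eq0; apply/eqP/setP => v; rewrite !inE andbF.
pose g v : 'I_m.+1 := inord (D y v).
rewrite -[leqRHS]card_ord; apply: (@leq_card_in _ _ g).
move=> u v /[1!in_set] /andP[uxy lt_um] /[1!in_set] /andP[vxy lt_vm].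
by move/(congr1 val); rewrite /= !inordK //; apply: interval_dist_inj uxy vxy.
Qed.

(* If [a] were farther from [y] than [v], it would have two neighbours closer to
   [y]: [v], and inductively the next vertex on the path from [a] to [x]. *)
Lemma closer_off_interval x y v a : v \notin interval e x y -> e v a ->
  D x a < D x v -> D y a < D y v.
Proof.
move Em: (D x v) => m; elim: m v a Em => // m IH v a Em vxy va lt_a.
have [|Dya] := dist_edge_cases y va; first lia.
have av : e a v by rewrite e_sym.
have axy : a \notin interval e x y.
  apply: contra vxy => axy; have [|//] := interval_closer e_sym axy av; lia.
have ax : a != x by apply: contraNneq axy => ->; apply: left_in_interval.
have [b ab Dxb] := closer_neighbour e_sym e_connected ax.
have Dyb : D y b < D y a.
  by apply: (IH a b) => //; have := dist_edge_cases x va; lia.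
have bv : b = v by apply: (nonfarther_neighbour_unique (r := y) ab av); lia.
by subst b; lia.
Qed.

Lemma common_closer_neighbour x y v w : v \notin interval e x y ->
    v \in interval e x w -> v \in interval e y w ->
  exists p, [/\ e w p, D x p < D x w & D y p < D y w].
Proof.
move=> vxy vxw vyw; have [wv|wv] := eqVneq w v.
  subst w; have vx : v != x.
    by apply: contraNneq vxy => ->; apply: left_in_interval.
  have [p vp Dxp] := closer_neighbour e_sym e_connected vx.
  have px : D x p < D x v by rewrite -Dxp.
  by exists p; split=> //; apply: closer_off_interval vp px.
have [p wp Dvp] := closer_neighbour e_sym e_connected wv.
exists p; move/(intervalP e_sym): vxw; move/(intervalP e_sym): vyw.
rewrite (dist_sym e_sym w).
have := dist_triangle e v x p; have := dist_triangle e v y p.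
by split=> //; lia.
Qed.

(* Among the vertices that [v] separates from both [x] and [y], one farthest
   from [v] is a leaf, as a second neighbour would be separated as well. *)
Lemma leaf_below x y v : v \notin interval e x y ->
  exists w, [/\ deg e w = 1, v \in interval e x w & v \in interval e y w].
Proof.
move=> vxy; pose below w := (v \in interval e x w) && (v \in interval e y w).
have below_v : below v by rewrite /below !right_in_interval.
case: (arg_maxnP (D v) below_v) => w /andP[vxw vyw] w_max.
exists w; split=> //; apply/eqP.
have V_gt1 : 1 < #|V|.
  apply/card_gt1P; exists x, v; split=> //; apply: contraNneq vxy => <-.
  exact: left_in_interval.
rewrite eqn_leq (deg_gt0 e_sym e_connected) // andbT leqNgt.
apply/negP => /neighbour_avoiding deg_w.
have [p [wp px py]] := common_closer_neighbour vxy vxw vyw.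
have [z wz zp] := deg_w p.
have farther r : D r p < D r w -> D r z = (D r w).+1.
  move=> pr; have [|//] := dist_edge_cases r wz => Drz; case/eqP: zp.
  by apply: (nonfarther_neighbour_unique (r := r) wz wp); lia.
have [vxz Dvz] := interval_extend e_sym vxw wz (farther x px).
have [vyz _] := interval_extend e_sym vyw wz (farther y py).
by have := w_max z; rewrite /below vxz vyz Dvz => /(_ isT); lia.
Qed.

Lemma dist_below_lt_half x y v w : v \notin interval e x y ->
    v \in interval e x w -> v \in interval e y w ->
    D x w <= D x y -> D y w <= D x y ->
  D w v < (D x y)./2.
Proof.
move=> /(dist_notin_interval e_sym) Dxy.
move=> /(intervalP e_sym) vxw /(intervalP e_sym) vyw.
by have := dist_parity x y v; lia.
Qed.

Lemma card_notin_interval_le x y : (forall u v, D u v <= D x y) ->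
  #|~: interval e x y| <= #|degree_class e 1 :\: [set x; y]| * (D x y)./2.
Proof.
move=> diam_xy; set L := _ :\: _; rewrite -sum_nat_const.
pose near w := [set v in interval e x w | D w v < (D x y)./2].
apply: (@leq_trans (\sum_(w in L) #|near w|)); last first.
  by apply: leq_sum => w _; apply: card_interval_ball.
apply: leq_trans (leq_card_bigcup _ _ _); apply/subset_leq_card/subsetP => v.
rewrite in_setC => vxy; have [w [deg_w vxw vyw]] := leaf_below vxy.
apply/bigcupP; exists w; last first.
  by rewrite in_set vxw (dist_below_lt_half vxy).
rewrite in_setD !inE negb_or deg_w eqxx andbT.
by apply/andP; split; apply: contraNneq vxy => <-; rewrite // interval_sym.
Qed.

Lemma card_le_leaves_diameter : 0 < diameter e ->
  #|V| <= (#|degree_class e 1| - 2) * (diameter e)./2 + (diameter e).+1.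
Proof.
have [x [y Dxy]] := diameter_attained e V_gt0; rewrite -{1}Dxy dist_gt0 => xy.
have diam_xy u v : D u v <= D x y by rewrite Dxy dist_le_diameter.
have leaf_y : deg e y = 1 by apply: deg_farthest xy _.
have leaf_x : deg e x = 1.
  by apply: (@deg_farthest y) => [|z]; rewrite 1?eq_sym // (dist_sym e_sym y x).
have <- : #|degree_class e 1 :\: [set x; y]| = #|degree_class e 1| - 2.
  rewrite cardsD (setIidPr _) ?cards2 ?xy //.
  by apply/subsetP => v; rewrite !inE => /orP[] /eqP ->; apply/eqP.
have : #|interval e x y| <= (D x y).+1.
  apply: leq_trans (card_interval_ball x y _).
  apply/subset_leq_card/subsetP => v vxy.
  by rewrite in_set vxy; move/(intervalP e_sym): vxy; lia.
have := card_notin_interval_le diam_xy; have := cardsC (interval e x y).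
by rewrite Dxy; lia.
Qed.

Lemma card_degree_classes : 1 < #|V| ->
  #|V| = #|degree_class e 1| + #|degree_class e 2| + #|branch_vertices e|.
Proof.
move=> V_gt1; rewrite !card_set_sum -!big_split -sum1_card.
apply: eq_bigr => x _ /=.
by have := deg_gt0 e_sym e_connected x V_gt1; case: (deg e x) => [|[|[|m]]].
Qed.

Lemma card_leaves_tree : 1 < #|V| ->
  #|degree_class e 1| = \sum_(x in branch_vertices e) (deg e x - 2) + 2.
Proof.
move=> V_gt1.
have : \sum_x deg e x + \sum_x (deg e x == 1)
       = \sum_(x : V) 2 + \sum_(x in branch_vertices e) (deg e x - 2).
  rewrite [\sum_(x in _) _]big_mkcond -!big_split; apply: eq_bigr => x _.
  rewrite inE /=; have := deg_gt0 e_sym e_connected x V_gt1.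
  by case: ifP; case: eqP; lia.
have -> : \sum_(x : V) 2 = 2 * #|V| by rewrite sum_nat_const mulnC.
by rewrite -sum_deg_tree -card_set_sum /degree_class; lia.
Qed.

Lemma card_branch_vertices_le : 1 < #|V| ->
  #|branch_vertices e| + 2 <= #|degree_class e 1|.
Proof.
move=> V_gt1; rewrite card_leaves_tree // leq_add2r -sum1_card.
by apply: leq_sum => x; rewrite inE subn_gt0.
Qed.

Lemma card_branch_vertices_gt0 : 1 < #|V| -> 2 < #|degree_class e 1| ->
  0 < #|branch_vertices e|.
Proof.
move=> V_gt1; apply: contraTT; rewrite -eqn0Ngt cards_eq0 => /eqP no_branch.
by rewrite card_leaves_tree // no_branch big_set0.
Qed.

Lemma alpha_reg_tree k : 2 <= k -> 2 < #|V| ->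
  alpha_reg e k = maxn #|degree_class e 1| #|degree_class e 2|.
Proof.
move=> k_ge2 V_gt2; have V_gt1 := ltnW V_gt2.
have k_ge1 := ltnW k_ge2; apply/eqP.
rewrite eqn_leq geq_max !card_degree_class_le_alpha_reg // !andbT.
apply: alpha_reg_le => -[|[|[|i]]]; rewrite leq_max ?leqnn ?orbT //.
  suff -> : degree_class e 0 = set0 by rewrite cards0.
  by apply/setP => x; rewrite !inE -leqn0 leqNgt (deg_gt0 e_sym e_connected).
apply/orP; left; apply: leq_trans (card_branch_vertices_le V_gt1).
apply: leq_trans (leq_addr _ _); apply/subset_leq_card/subsetP => x.
by rewrite !inE => /eqP ->.
Qed.

Lemma f_le_card_leaves t : diameter e = #|V| - t -> t <= #|V| - 2 -> 1 < #|V| ->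
  f #|V| t <= #|degree_class e 1|.
Proof.
move=> diamT t_le V_gt1.
have leaves_gt1 : 1 < #|degree_class e 1|.
  exact: leq_trans (leq_addl _ 2) (card_branch_vertices_le V_gt1).
have d_gt0 : 0 < diameter e by rewrite diamT; lia.
have := card_le_leaves_diameter d_gt0; rewrite diamT leq_f //; last by lia.
by move: (_ * _) => m; lia.
Qed.

End Tree.

Theorem theorem3p1 (k : nat) (V : finType) (e : rel V) (n t : nat)
    (k_ge2 : 2 <= k) (treeT : tree e) (orderT : #|V| = n) (n_ge8 : 8 <= n)
    (t_ge2 : 2 <= t) (t_le : t <= n - 3) (diamT : diameter e = n - t) :
  [/\ 3 * t <= n - 1 -> n - 2 * t <= alpha_reg e k <= n - 4,
      n <= 3 * t -> t <= n - 5 ->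
        n + 2 <= 3 * alpha_reg e k /\
        alpha_reg e k <= maxn (n - f n t - 1) (t + 1),
      t = n - 4 -> ceil_divn (n - 1) 2 <= alpha_reg e k <= t + 1
    & t = n - 3 -> alpha_reg e k = t + 1].
Proof.
have V_gt1 : 1 < #|V| by rewrite orderT; lia.
have f_ge3 : 3 <= f n t by rewrite ltnNge leq_f //; lia.
have le_f : f n t <= #|degree_class e 1|.
  by rewrite -orderT; apply: f_le_card_leaves; rewrite ?orderT //; lia.
have leaves_le : #|degree_class e 1| <= t + 1.
  have e_sym : symmetric e by case: treeT => -[].
  have e_connected : connected_graph e by case: treeT.
  by have := card_leaves_diameter_le e_sym e_connected (ltnW V_gt1); lia.
have leaves_gt2 := leq_trans f_ge3 le_f.
have order_sum := card_degree_classes treeT V_gt1.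
have branch_le := card_branch_vertices_le treeT V_gt1.
have branch_gt0 := card_branch_vertices_gt0 treeT V_gt1 leaves_gt2.
rewrite (alpha_reg_tree treeT k_ge2); last by lia.
split; [lia | lia | move=> tE | move=> tE].
- have half_d : (n - t)./2 = 2 by lia.
  by move: le_f; rewrite leq_ceil_divn // leq_f ?half_d; lia.
have half_d : (n - t)./2 = 1 by lia.
by move: le_f; rewrite leq_f ?half_d; lia.
Qed.
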